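(* Let $U,\hat U$ be Hilbert spaces, $Q:U\to\hat U$ a bounded linear operator, and for $n\ge 0$ let $U_n$, $R_n$, $E_n$ be the $n$th iterate map, residual map and error map of an admissible iteration associated with $Q$. Let $(w,u^{(0)})$ and $(\tilde w,\tilde u^{(0)})$ be two pairs in $\hat U\times U$ such that $$Q^*(Qu^{(0)}-w)=Q^*(Q\tilde u^{(0)}-\tilde w).$$ Then, for all $n\ge0$, $$U_n(\tilde w,\tilde u^{(0)})-U_n(w,u^{(0)})=\tilde u^{(0)}-u^{(0)}\quad\text{and}\quad R_n(\tilde w,\tilde u^{(0)})=R_n(w,u^{(0)}).$$ Moreover, if $w$ or $\tilde w$ belongs to $\mathcal D(Q^\dagger)$, then $E_n(w,u^{(0)})=E_n(\tilde w,\tilde u^{(0)})$ for all $n\ge0$ (in particular both sides are defined).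
   Context: $Q^*$ is the adjoint of $Q$ and $\operatorname{ran}$ denotes range. $M_{Q,w}:=\{u\in U:\|Qu-w\|=\inf_{v\in U}\|Qv-w\|\}$, and $\mathcal D(Q^\dagger):=\{w\in\hat U:M_{Q,w}\neq\emptyset\}=\operatorname{ran}(Q)\oplus\operatorname{ran}(Q)^\perp$ is the domain of the Moore-Penrose pseudoinverse. $P_S$ is the orthogonal projection onto a nonempty closed affine subspace $S$. An admissible iteration is specified by a sequence of sets $(\mathscr S_n)_{n\ge0}$ (state spaces) with $\mathscr S_0=\{0\}$ and a sequence of mappings $J_n:(\operatorname{ran}(Q^* )\setminus\{0\})\times\mathscr S_n\to\operatorname{ran}(Q^* )\times\mathscr S_{n+1}$, $n\ge0$. Given $(w,u^{(0)})\in\hat U\times U$ and $s^{(0)}=0$, it generates, for $n\ge0$, $r^{(n)}=Q^*(Qu^{(n)}-w)$, $(d^{(n)},s^{(n+1)})=J_n(r^{(n)},s^{(n)})$, $u^{(n+1)}=u^{(n)}+d^{(n)}$. The iteration is terminated as soon as $r^{(n)}=0$, in which case the sequence is regarded as constant from then on ($u^{(m)}=u^{(n)}$ and $r^{(m)}=0$ for $m\ge n$). With $(J_n)_{n\ge0}$ fixed, one writes $u^{(n)}=U_n(w,u^{(0)})$, $r^{(n)}=R_n(w,u^{(0)})$, and, when $M_{Q,w}\ne\emptyset$, $E_n(w,u^{(0)}):=U_n(w,u^{(0)})-P_{M_{Q,w}}u^{(0)}$. *)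

(* Defs.v *)
From HB Require Import structures.
From mathcomp Require Import all_boot all_order all_algebra complex.
From mathcomp Require Import all_classical all_reals all_analysis.

Set Implicit Arguments.
Unset Strict Implicit.
Unset Printing Implicit Defensive.

Import Order.TTheory GRing.Theory Num.Theory.
Import numFieldNormedType.Exports.

Local Open Scope classical_set_scope.
Local Open Scope ring_scope.

Variant scalar_kind := RealScalars | ComplexScalars.

Definition scalar (R : realType) (k : scalar_kind) : numFieldType :=
  match k with
  | RealScalars => R
  | ComplexScalars => R[i]
  end.

Definition scalar_conj (R : realType) (k : scalar_kind) :
    scalar R k -> scalar R k :=
  match k return scalar R k -> scalar R k with
  | RealScalars => fun x => x
  | ComplexScalars => fun x : R[i] => Num.conj x
  end.

(* The inner product is linear in its first argument and conjugate-linear in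
   the second one. *)
HB.mixin Record isHilbert (R : realType) (k : scalar_kind) U
    of CompleteNormedModule (scalar R k) U := {
  inner : {dot U for @scalar_conj R k} ;
  innervv : forall u : U, inner u u = `|u| ^+ 2 ;
}.

#[short(type="hilbertType")]
HB.structure Definition Hilbert (R : realType) (k : scalar_kind) :=
  {U of isHilbert R k U & CompleteNormedModule (scalar R k) U}.

Section HilbertSpaces.
Context {R : realType} {k : scalar_kind}.
Implicit Types U V : hilbertType R k.

Definition bounded_operator U V (Q : U -> V) :=
  exists C : scalar R k, forall u, `|Q u| <= C * `|u|.

(* By the Riesz representation theorem, the default value 0 is never used when
   Q is a bounded linear operator. *)
Definition adjoint U V (Q : U -> V) (w : V) : U :=
  xget 0 [set v | forall u, inner (Q u) w = inner u v].

Definition is_orth_proj U (S : set U) (u p : U) :=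
  S p /\ forall s, S s -> inner (u - p) (s - p) = 0.

(* The default value 0 is never used when S is a nonempty closed affine
   subspace. *)
Definition orth_proj U (S : set U) (u : U) : U :=
  xget 0 [set p | is_orth_proj S u p].

(* For complex scalars, norms are elements of R[i], whose order is partial and
   only relates elements that differ by a real number; the infimum of a
   nonempty set of norms is the same as in R. *)
Definition least_squares U V (Q : U -> V) (w : V) : set U :=
  [set u | infimums (range (fun v => `|Q v - w|)) `|Q u - w|].

Definition pinv_domain U V (Q : U -> V) : set V :=
  [set w | least_squares Q w !=set0].

Record admissible_iteration U V (Q : U -> V) := AdmissibleIteration {
  state : nat -> Type ;
  state0 : state 0 ;
  state0_unique : forall s : state 0, s = state0 ;
  step : forall n, set_type (range (adjoint Q) `\ 0) * state n ->
                   set_type (range (adjoint Q)) * state n.+1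
}.

Section Iteration.
Context {U V : hilbertType R k} (Q : U -> V) (J : admissible_iteration Q).
Implicit Types (w : V) (u : U) (n : nat).

Definition gradient w u : U := adjoint Q (Q u - w).

Lemma isSome_insub_gradient w u :
  isSome (insub (gradient w u) : option (set_type (range (adjoint Q) `\ 0)))
  = (gradient w u != 0).
Proof.
have -> : isSome (insub (gradient w u)
    : option (set_type (range (adjoint Q) `\ 0)))
  = (gradient w u \in range (adjoint Q) `\ 0) by case: insubP => [v -> //|/negbTE].
apply/idP/idP => [/set_mem[_ /eqP //]|/eqP g0].
by apply/mem_set; split => //; exists (Q u - w).
Qed.

(* The n-th iterate together with the n-th state; the latter is None once the
   iteration has been terminated. A residual lies in the range of the adjoint,
   so that insub fails exactly when it vanishes. *)
Fixpoint run w u n : U * option (state J n) :=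
  match n return U * option (state J n) with
  | 0 => (u, Some (state0 J))
  | m.+1 =>
    let: (v, os) := run w u m in
    match insub (gradient w v), os with
    | Some r, Some s => let: (d, s') := step (r, s) in (v + val d, Some s')
    | _, _ => (v, None)
    end
  end.

Definition iterate w u n : U := (run w u n).1.

Definition residual w u n : U := gradient w (iterate w u n).

Definition error w u n : U :=
  iterate w u n - orth_proj (least_squares Q w) u.

(* The second clause asserts that the default value of orth_proj is not used. *)
Definition error_defined w u :=
  pinv_domain Q w /\
  is_orth_proj (least_squares Q w) u (orth_proj (least_squares Q w) u).

End Iteration.

End HilbertSpaces.

(* Main.v *)
Require Import Defs.
From HB Require Import structures.
From mathcomp Require Import all_boot all_order all_algebra complex.
From mathcomp Require Import all_classical all_reals all_analysis.
From mathcomp Require Import ring.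

Import Order.TTheory GRing.Theory Num.Theory.
Import numFieldNormedType.Exports.

Local Open Scope classical_set_scope.
Local Open Scope ring_scope.

(* An iteration step sees the data only through the gradient Q^*(Qv - w), and
   the gradient for w' at v + (u' - u) equals the gradient for w at v; so the two
   runs stay translates of each other by u' - u. By the normal equations
   Q^*(Qv - w) = 0 the same translation maps the least-squares solutions for w
   onto those for w', hence also the projection of u onto that of u', and it
   cancels in the errors. *)

(** * Scalars: conjugation and infima *)

Lemma scalar_conj_is_zmod_morphism (R : realType) (k : scalar_kind) :
  zmod_morphism (@scalar_conj R k).
Proof. by case: k => x y //=; rewrite rmorphB. Qed.

Lemma scalar_conj_is_monoid_morphism (R : realType) (k : scalar_kind) :
  monoid_morphism (@scalar_conj R k).
Proof. by case: k; split=> [|x y] //=; rewrite ?rmorph1 ?rmorphM. Qed.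

HB.instance Definition _ (R : realType) (k : scalar_kind) :=
  GRing.isZmodMorphism.Build _ _ (@scalar_conj R k)
    (scalar_conj_is_zmod_morphism R k).
HB.instance Definition _ (R : realType) (k : scalar_kind) :=
  GRing.isMonoidMorphism.Build _ _ (@scalar_conj R k)
    (scalar_conj_is_monoid_morphism R k).

Lemma normCK_scalar {R : realType} {k : scalar_kind} (x : Defs.scalar R k) :
  `|x| ^+ 2 = x * scalar_conj x.
Proof.
case: k x => x /=; last by rewrite normCK.
by rewrite real_normK ?num_real// expr2.
Qed.

Lemma scalar_conj_ge0 {R : realType} {k : scalar_kind} (x : Defs.scalar R k) :
  0 <= x -> scalar_conj x = x.
Proof. by case: k x => x //= x0; rewrite conj_Creal// ger0_real. Qed.

(** Nonnegative complex numbers are real, so over [R[i]] the infimum is computed in [R] on real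
    parts and embedded back. *)
Lemma nonneg_scalar_inf {R : realType} {k : scalar_kind}
    (A : set (Defs.scalar R k)) :
  A !=set0 -> (forall a, A a -> 0 <= a) ->
  exists2 d, (forall a, A a -> d <= a) &
    forall e, 0 < e -> exists2 a, A a & a < d + e.
Proof.
case: k A => /= A [a0 Aa0] A_ge0.
  have Ainf : has_inf A by split; [exists a0|exists 0; exact: A_ge0].
  exists (inf A) => [a Aa|e e0]; last exact: inf_adherent.
  exact: ge_inf Ainf.2 _ Aa.
have ReK (x : R[i]) : 0 <= x -> ((complex.Re x)%:C)%C = x.
  by case: x => a b; rewrite lecE /= => /andP[/eqP -> _].
pose B := [set r : R | A r%:C%C].
have Binf : has_inf B.
  split; first by exists (complex.Re a0); rewrite /B /= ReK //; exact: A_ge0.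
  by exists 0 => r /A_ge0; rewrite lecR.
exists ((inf B)%:C%C) => [a Aa|e e0].
  rewrite -(ReK a) ?A_ge0// lecR; apply: ge_inf Binf.2 _ _.
  by rewrite /B /= ReK// A_ge0.
have eE := ReK e (ltW e0).
have [|b Bb blt] := @inf_adherent _ B (complex.Re e) _ Binf.
  by rewrite -ltcR eE.
by exists b%:C%C => //; rewrite -eE -rmorphD ltcR.
Qed.

Lemma ge0_le_eps_eq0 {K : numFieldType} (c x : K) :
  0 <= c -> 0 <= x -> (forall e, 0 < e -> x <= e * c) -> x = 0.
Proof.
move=> c0 x0 xle; apply/eqP; case: eqVneq => // xN0.
have xgt : 0 < x by rewrite lt_neqAle eq_sym xN0.
have c1 : 0 < c + 1 by rewrite ltr_wpDl.
have := xle (x / (c + 1)) (divr_gt0 xgt c1).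
rewrite mulrAC ler_pdivlMr// ler_pM2l// gerDl => le10.
by have := lt_le_trans ltr01 le10; rewrite ltxx.
Qed.

(** * Inner product identities and inequalities *)

Section HilbertTheory.
Context {R : realType} {k : scalar_kind}.
Implicit Types U V : hilbertType R k.

Lemma innerDl {U} (u v w : U) : inner (u + v) w = inner u w + inner v w.
Proof. exact: linearDl. Qed.

Lemma innerBl {U} (u v w : U) : inner (u - v) w = inner u w - inner v w.
Proof. exact: linearBl. Qed.

Lemma innerZl {U} c (u v : U) : inner (c *: u) v = c * inner u v.
Proof. exact: linearZl_LR. Qed.

Lemma innerDr {U} (u v w : U) : inner u (v + w) = inner u v + inner u w.
Proof. exact: linearDr. Qed.

Lemma innerBr {U} (u v w : U) : inner u (v - w) = inner u v - inner u w.
Proof. exact: linearBr. Qed.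

Lemma innerZr {U} c (u v : U) : inner u (c *: v) = scalar_conj c * inner u v.
Proof. exact: linearZr_LR. Qed.

Lemma inner0r {U} (u : U) : inner u 0 = 0.
Proof. exact: linear0r. Qed.

Lemma innerC {U} (u v : U) : inner u v = scalar_conj (inner v u).
Proof. by rewrite hermC expr0 mul1r. Qed.

Lemma inner_eq0C {U} (u v : U) : inner u v = 0 -> inner v u = 0.
Proof. by move=> uv0; rewrite innerC uv0 rmorph0. Qed.

Lemma inner_injr {U} (x y : U) : (forall u, inner u x = inner u y) -> x = y.
Proof.
move=> xy; apply/subr0_eq/eqP; rewrite -normr_eq0 -sqrf_eq0 -innervv.
by rewrite innerBr xy -innerBr subrr inner0r.
Qed.

(* The subtracted multiple of [h] is the orthogonal projection of [a] on the
   line spanned by [h]. *)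
Lemma sqr_norm_sub_proj {U} (a h : U) : h != 0 ->
  `|a - (inner a h / `|h| ^+ 2) *: h| ^+ 2
    = `|a| ^+ 2 - `|inner a h| ^+ 2 / `|h| ^+ 2.
Proof.
move=> h0; have hh0 : `|h| ^+ 2 != 0 by rewrite sqrf_eq0 normr_eq0.
set t := _ / _.
have b0 : inner (a - t *: h) h = 0.
  by rewrite innerBl innerZl innervv /t divfK// subrr.
rewrite -innervv innerBr innerZr b0 mulr0 subr0 innerBl innerZl.
by rewrite innervv (innerC h a) /t mulrAC -normCK_scalar.
Qed.

(** The lower bound [d] is applied at the minimum along the line, given by [sqr_norm_sub_proj].
    Taking [e = 0] yields orthogonality at a minimiser and [d = 0] yields Cauchy-Schwarz; a general
    [e] serves the near-minimisers of the projection theorem. *)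
Lemma sqr_inner_le_near_min {U} (a h : U) (d e : Defs.scalar R k) :
  `|a| ^+ 2 <= d + e -> (forall t, d <= `|a - t *: h| ^+ 2) ->
  `|inner a h| ^+ 2 <= e * `|h| ^+ 2.
Proof.
move=> ade dle; have [->|h0] := eqVneq h 0.
  by rewrite inner0r !normr0 expr0n mulr0.
have hh0 : 0 < `|h| ^+ 2 by rewrite exprn_gt0// normr_gt0.
rewrite -ler_pdivrMr//.
have := dle (inner a h / `|h| ^+ 2).
by rewrite sqr_norm_sub_proj// lerBrDr => /le_trans/(_ ade); rewrite lerD2l.
Qed.

Lemma inner_eq0_of_min {U} (a h : U) :
  (forall t, `|a| <= `|a - t *: h|) -> inner a h = 0.
Proof.
move=> amin; apply/eqP; rewrite -normr_eq0 -sqrf_eq0 eq_le exprn_ge0// andbT.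
rewrite -(mul0r (`|h| ^+ 2)) (@sqr_inner_le_near_min _ _ _ (`|a| ^+ 2))//.
  by rewrite addr0.
by move=> t; rewrite ler_pXn2r ?nnegrE.
Qed.

Lemma cauchy_schwarz {U} (a h : U) : `|inner a h| <= `|a| * `|h|.
Proof.
rewrite -(@ler_pXn2r _ 2) ?nnegrE ?mulr_ge0// exprMn.
by apply: (@sqr_inner_le_near_min _ _ _ 0) => [|t]; rewrite ?add0r ?exprn_ge0.
Qed.

Lemma parallelogram {U} (a b : U) :
  `|a + b| ^+ 2 + `|a - b| ^+ 2 = (`|a| ^+ 2 + `|b| ^+ 2) *+ 2.
Proof.
rewrite -!innervv !(innerBl, innerBr, innerDl, innerDr).
ring.
Qed.

(** * Orthogonal projection onto closed affine sets *)

Definition affine {U} (S : set U) :=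
  forall r s t c, S r -> S s -> S t -> S (r + c *: (t - s)).

(** By the parallelogram law, near-minimisers of the squared distance to [u] form a Cauchy filter,
    which converges by completeness. Orthogonality at the limit is read off from near-minimisers
    close to it, without first proving that the limit attains the minimum. *)
Lemma orth_proj_exists {U} (S : set U) (u : U) :
  closed S -> affine S -> S !=set0 -> exists p, is_orth_proj S u p.
Proof.
move=> Sclosed Saff [s0 Ss0].
pose A := [set `|u - s| ^+ 2 | s in S].
have [|a [s _ <-]|d dle dadh] := @nonneg_scalar_inf _ _ A.
- by exists (`|u - s0| ^+ 2), s0.
- exact: exprn_ge0.
pose near_min (e : Defs.scalar R k) := [set s | S s /\ `|u - s| ^+ 2 < d + e].
pose F := filter_from [set e : Defs.scalar R k | 0 < e] near_min.
have near_min0 e : 0 < e -> near_min e !=set0.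
  by move=> /dadh[_ [s Ss <-]] slt; exists s.
have FF : ProperFilter F.
  apply: filter_from_proper => //; apply: filter_from_filter.
    by exists 1; exact: ltr01.
  move=> e1 e2 /= e1_gt0 e2_gt0.
  (* The order on complex scalars is partial, but positive scalars are real, hence comparable. *)
  have cmp : e1 >=< e2 by rewrite real_comparable// gtr0_real.
  exists (Order.min e1 e2); first by rewrite comparable_lt_min ?e1_gt0.
  by move=> s [Ss]; rewrite -ltrBlDl comparable_lt_min// !ltrBlDl => /andP[].
(* The midpoint of [s] and [t] lies in [S], so its squared distance to [u] is at least [d]. *)
have mid s t : S s -> S t -> `|s - t| ^+ 2 <=
    (`|u - s| ^+ 2 + `|u - t| ^+ 2) *+ 2 - d *+ 4.
  move=> Ss St; have := parallelogram (u - s) (u - t).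
  have := dle _ (imageP _ (Saff s s t 2^-1 Ss Ss St)).
  have -> : (u - s) + (u - t) = 2 *: (u - (s + 2^-1 *: (t - s))).
    rewrite scalerBr scalerDr scalerA divff ?pnatr_eq0// scale1r !scaler_nat.
    by rewrite !mulr2n [s + s + _]addrACA subrr addr0 opprD addrACA.
  have -> : (u - s) - (u - t) = t - s by rewrite opprB addrC subrKA.
  rewrite normrZ exprMn ger0_norm ?ler0n// => d_le <-.
  rewrite distrC [leRHS]addrAC lerDr subr_ge0 -natrX -(mulr_natl d 4).
  by rewrite ler_pM2l// ltr0n.
have Fcauchy : cauchy F.
  apply: cauchy_exP => e /= e0.
  (* Two squared distances below [d + e ^+ 2 / 4] make the bound in [mid] smaller than [e ^+ 2]. *)
  have e'0 : 0 < e ^+ 2 / 4 by rewrite divr_gt0// exprn_gt0.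
  have [s [Ss slt]] := near_min0 _ e'0.
  exists s, (e ^+ 2 / 4) => // t [St tlt]; rewrite -ball_normE /=.
  rewrite -(@ltr_pXn2r _ 2) ?nnegrE ?(ltW e0)//.
  apply: le_lt_trans (mid _ _ Ss St) _; rewrite ltrBlDr.
  have -> : e ^+ 2 + d *+ 4 = ((d + e ^+ 2 / 4) + (d + e ^+ 2 / 4)) *+ 2.
    by field.
  by rewrite ltr_pMn2r// ltrD.
have Fcvg : cvg F by exact: cauchy_cvg.
exists (lim F).
(* The slack is [e ^+ 2] so that, after a square root, it contributes a term linear in [e]. *)
have approx e : 0 < e -> exists s, near_min (e ^+ 2) s /\ `|s - lim F| < e.
  move=> e0; have e20 : 0 < e ^+ 2 by rewrite exprn_gt0.
  have Fb : F (ball (lim F) e) by apply: Fcvg; exact: nbhsx_ballx.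
  have Fn : F (near_min (e ^+ 2)) by exists (e ^+ 2).
  have [s [? sb]] := filter_ex (filterI Fn Fb).
  by exists s; split => //; move: sb; rewrite -ball_normE /= distrC.
have Sp : S (lim F).
  apply: Sclosed => B /nbhs_ballP[e /= e0 eB].
  have [s [[Ss _] se]] := approx e e0.
  by exists s; split => //; apply: eB; rewrite -ball_normE /= distrC.
split=> // s Ss; set p := lim F in approx *; set h := s - p.
apply/eqP; rewrite -normr_eq0; apply/eqP.
apply: (@ge0_le_eps_eq0 _ (`|h| *+ 2)) => [||e e0]; rewrite ?mulrn_wge0//.
have [t [[St tlt] tp]] := approx e e0.
(* [u - t] is almost orthogonal to [h] by near-minimality of [t], and [t - p] is short: each term
   contributes at most [e] times the norm of [h]. *)
have -> : u - p = (u - t) + (t - p) by rewrite subrKA.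
rewrite innerDl mulrnAr mulr2n; apply: le_trans (ler_normD _ _) _.
apply: lerD; last first.
  by apply: le_trans (cauchy_schwarz _ _) _; rewrite ler_wpM2r// ltW.
rewrite -(@ler_pXn2r _ 2) ?nnegrE ?mulr_ge0 ?(ltW e0)// exprMn.
apply: sqr_inner_le_near_min (ltW tlt) _ => c.
by rewrite -addrA -opprD; apply: dle; exists (t + c *: h) => //;
  exact: Saff.
Qed.

(** [p - q] is the difference of [u - q] and [u - p], both orthogonal to [p - q]. *)
Lemma orth_proj_unique {U} (S : set U) (u p q : U) :
  is_orth_proj S u p -> is_orth_proj S u q -> p = q.
Proof.
move=> [Sp pP] [Sq qP]; apply/subr0_eq/eqP.
rewrite -normr_eq0 -sqrf_eq0 -innervv.
have {1}-> : p - q = (u - q) - (u - p) by rewrite opprB [RHS]addrC subrKA.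
by rewrite innerBl qP// -(opprB q p) -(scaleN1r (q - p)) innerZr pP// mulr0 subrr.
Qed.

Lemma orth_projP {U} (S : set U) (u : U) :
  closed S -> affine S -> S !=set0 -> is_orth_proj S u (orth_proj S u).
Proof.
by move=> cS aS S0; exact: (xgetPex 0 (orth_proj_exists S u cS aS S0)).
Qed.

Lemma is_orth_proj_translate {U} (S T : set U) (a u p : U) :
  (forall x, T (x + a) <-> S x) -> is_orth_proj S u p ->
  is_orth_proj T (u + a) (p + a).
Proof.
move=> TS [Sp pP]; split=> [|s Ts]; first exact/TS.
have -> : s - (p + a) = (s - a) - p by rewrite opprD addrA addrAC.
rewrite opprD addrACA subrr addr0.
by apply: pP; apply/TS; rewrite subrK.
Qed.

(** * Closed level sets and Riesz representation *)

Lemma closed_level_set {U} (f : U -> Defs.scalar R k) (C c : Defs.scalar R k) :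
  0 <= C -> (forall x y, `|f x - f y| <= C * `|x - y|) ->
  closed [set u | f u = c].
Proof.
move=> C0 fC p pcl; apply/subr0_eq/eqP; rewrite -normr_eq0; apply/eqP.
apply: (@ge0_le_eps_eq0 _ C) => // e e0.
have [s [/= <-]] := pcl _ (nbhsx_ballx p e e0).
rewrite -ball_normE /= => pse; apply: le_trans (fC _ _) _.
by rewrite mulrC ler_wpM2r// ltW.
Qed.

(** For nonzero [f], the projection [p] of 0 onto the hyperplane where [f] is 1 is orthogonal to the
    kernel of [f]; rescaling [p] gives the representing vector. *)
Lemma riesz {U} (f : U -> Defs.scalar R k) (C : Defs.scalar R k) :
  (forall c x y, f (c *: x + y) = c * f x + f y) ->
  0 <= C -> (forall x, `|f x| <= C * `|x|) ->
  exists v, forall u, f u = inner u v.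
Proof.
move=> flin C0 fC.
have f0 : f 0 = 0 by have := flin (-1) 0 0; rewrite scaler0 addr0 mulN1r addNr.
have fZ c x : f (c *: x) = c * f x by rewrite -[c *: x]addr0 flin f0 addr0.
have fB x y : f (x - y) = f x - f y.
  by rewrite addrC -scaleN1r flin mulN1r addrC.
have [[x fx0]|fN] := pselect (exists x, f x != 0); last first.
  exists 0 => u; rewrite inner0r; apply/eqP; apply: contrapT => /negP fu.
  by apply: fN; exists u.
pose S := [set u | f u = 1].
have [] := @orth_proj_exists _ S 0.
- by apply: (@closed_level_set _ _ C) => // y z; rewrite -fB.
- by rewrite /S => r s t c /= fr fs ft; rewrite addrC flin fB fr fs ft subrr mulr0 add0r.
- by exists ((f x)^-1 *: x); rewrite /S /= fZ mulVf.
move=> p [fp pP].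
have p0 : p != 0.
  by apply/eqP => pE; move: fp; rewrite /S /= pE f0 => /esym/eqP; rewrite oner_eq0.
have pp0 : `|p| ^+ 2 != 0 by rewrite sqrf_eq0 normr_eq0.
(* Since [u - f u *: p] is in the kernel of [f], it is orthogonal to [p], so [inner u p] is [f u]
   times the squared norm of [p]; this dictates the factor. *)
exists ((`|p| ^+ 2)^-1 *: p) => u.
have Sv : S (u - f u *: p + p).
  by rewrite /S /= addrC -{1}[p]scale1r flin fB fZ fp !mulr1 subrr addr0.
have := pP _ Sv; rewrite addrK sub0r -(scaleN1r p) innerZl mulN1r => /eqP.
rewrite oppr_eq0 => /eqP/inner_eq0C.
rewrite innerBl innerZl innervv => /subr0_eq up.
rewrite innerZr up scalar_conj_ge0 ?invr_ge0 ?exprn_ge0//.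
by rewrite mulrCA mulVf// mulr1.
Qed.

(** * Adjoint and normal equations *)

Section Operators.
Context {U V : hilbertType R k} {Q : {linear U -> V}}.
Hypothesis Q_bounded : bounded_operator Q.

(** The given constant can fail to be nonnegative only when [U] is trivial. *)
Lemma bounded_operator_ge0 :
  exists2 C : Defs.scalar R k, 0 <= C & forall u, `|Q u| <= C * `|u|.
Proof.
have [C QC] := Q_bounded; exists `|C| => // u.
by rewrite -[leRHS]ger0_norm ?mulr_ge0// normrM normr_id -normrM ger0_norm
  ?(le_trans _ (QC u)).
Qed.

(** Riesz, applied to the bounded functional sending [u] to [inner (Q u) w], rules out the default
    value of [xget]. *)
Lemma adjointP (v : U) (w : V) : inner (Q v) w = inner v (adjoint Q w).
Proof.
have [C C0 QC] := bounded_operator_ge0.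
have [|||a aP] := @riesz _ (fun u => inner (Q u) w) (C * `|w|).
- by move=> c x y; rewrite linearP innerDl innerZl.
- exact: mulr_ge0.
- move=> x; apply: le_trans (cauchy_schwarz _ _) _.
  by rewrite mulrAC ler_wpM2r.
by have := @xgetPex _ 0 [set v | forall u, inner (Q u) w = inner u v];
  rewrite /adjoint => ->//; exists a.
Qed.

Lemma adjointD (w w' : V) : adjoint Q (w + w') = adjoint Q w + adjoint Q w'.
Proof. by apply: inner_injr => u; rewrite innerDr -!adjointP innerDr. Qed.

(** Normal equations: a minimiser competes with every [u - t *: v], which forces orthogonality;
    Pythagoras gives the converse. *)
Lemma least_squaresE (w : V) :
  least_squares Q w = [set u | forall v, inner (Q u - w) (Q v) = 0].
Proof.
apply/seteqP; split=> u /=.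
  move=> [umin _] v; apply: inner_eq0_of_min => t; apply: umin.
  by exists (u - t *: v); rewrite // linearB linearZ_LR addrAC.
(* The infimum is attained at [u], so every lower bound [a] is below it at once. *)
move=> u0; split=> [_ [v _ <-]|a]; last by apply; exists u.
rewrite -(@ler_pXn2r _ 2) ?nnegrE//.
have -> : Q v - w = (Q u - w) + Q (v - u) by rewrite [RHS]addrC linearB subrKA.
move: (Q u - w) u0 => e u0.
rewrite -!innervv innerDl !innerDr u0 (inner_eq0C _ _ (u0 _)) addr0 add0r.
by rewrite lerDl innervv exprn_ge0.
Qed.

Lemma closed_least_squares (w : V) : closed (least_squares Q w).
Proof.
have [C C0 QC] := bounded_operator_ge0.
have -> : least_squares Q w =
    \bigcap_(v in setT) [set u | inner (Q u - w) (Q v) = 0].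
  by rewrite least_squaresE; apply/seteqP; split=> u h v => [_|]; exact: h.
apply: closed_bigI => v _.
apply: (@closed_level_set _ _ (C * `|Q v|)) => [|x y]; first exact: mulr_ge0.
rewrite -innerBl opprB addrA subrK -linearB.
by apply: le_trans (cauchy_schwarz _ _) _; rewrite mulrAC ler_wpM2r.
Qed.

Lemma affine_least_squares (w : V) : affine (least_squares Q w).
Proof.
rewrite least_squaresE => r s t c /= r0 s0 t0 v.
rewrite linearD linearZ_LR linearB addrAC innerDl r0 innerZl add0r.
have -> : Q t - Q s = (Q t - w) - (Q s - w) by rewrite opprB subrKA.
by rewrite innerBl s0 t0 subrr mulr0.
Qed.

Lemma error_definedP (w : V) (u : U) : pinv_domain Q w -> error_defined Q w u.
Proof.
move=> Mw; split=> //.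
exact: orth_projP (closed_least_squares w) (affine_least_squares w) Mw.
Qed.

(** * Translation between problems with equal initial residuals *)

Section SameInitialResidual.
Context {w w' : V} {u u' : U}.
Hypothesis same_initial_residual :
  adjoint Q (Q u - w) = adjoint Q (Q u' - w').

(** Both gradients split into [adjoint Q (Q v - Q u)] plus an initial residual, and the initial
    residuals agree. *)
Lemma gradient_translate (v : U) :
  gradient Q w' (v + (u' - u)) = gradient Q w v.
Proof.
have eQ : Q (v + (u' - u)) - w' = (Q v - Q u) + (Q u' - w').
  by rewrite linearD linearB [Q u' - Q u]addrC !addrA.
have -> : gradient Q w v = adjoint Q ((Q v - Q u) + (Q u - w)).
  by rewrite subrKA.
by rewrite /gradient eQ adjointD [RHS]adjointD same_initial_residual.
Qed.

Lemma least_squares_translate (v : U) :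
  least_squares Q w' (v + (u' - u)) <-> least_squares Q w v.
Proof.
(* Conjugate symmetry moves [Q y] to the first slot, where [adjointP] turns the other slot into a
   gradient. *)
have eqM x y : inner (Q (x + (u' - u)) - w') (Q y) = inner (Q x - w) (Q y).
  by rewrite innerC [RHS]innerC !adjointP [adjoint _ _]gradient_translate.
by rewrite !least_squaresE; split=> h y; have := h y; rewrite eqM.
Qed.

Lemma pinv_domain_translate : pinv_domain Q w' <-> pinv_domain Q w.
Proof.
split=> -[v]; last by exists (v + (u' - u)); exact/least_squares_translate.
rewrite -[v](subrK (u' - u)) => /least_squares_translate.
by exists (v - (u' - u)).
Qed.

(** The states must be carried through the induction: equal gradients make [insub] fail at the same
    index in both runs, and otherwise [step] receives identical arguments. *)
Lemma run_translate (J : admissible_iteration Q) (n : nat) :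
  run J w' u' n = ((run J w u n).1 + (u' - u), (run J w u n).2).
Proof.
elim: n => [|n IHn] /=; first by rewrite addrC subrK.
rewrite IHn; case: (run J w u n) => v os /=; rewrite gradient_translate.
case: insub => [r|//]; case: os => [s|//].
by case: step => d s' /=; rewrite addrAC.
Qed.

Lemma orth_proj_translate : pinv_domain Q w ->
  orth_proj (least_squares Q w') u' = orth_proj (least_squares Q w) u + (u' - u).
Proof.
move=> Mw; have [_ P'] := error_definedP w' u' (pinv_domain_translate.2 Mw).
apply: orth_proj_unique P' _.
have {1}-> : u' = u + (u' - u) by rewrite addrC subrK.
exact: is_orth_proj_translate least_squares_translate (error_definedP w u Mw).2.
Qed.

End SameInitialResidual.
End Operators.
End HilbertTheory.

Theorem theorem3p3 (R : realType) (k : scalar_kind) (U V : hilbertType R k)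
    (Q : {linear U -> V}) (Q_bounded : bounded_operator Q)
    (J : admissible_iteration Q) (w w' : V) (u u' : U)
    (same_initial_residual :
       adjoint Q (Q u - w) = adjoint Q (Q u' - w')) :
  (forall n : nat,
     iterate J w' u' n - iterate J w u n = u' - u /\
     residual J w' u' n = residual J w u n) /\
  (pinv_domain Q w \/ pinv_domain Q w' ->
     error_defined Q w u /\ error_defined Q w' u' /\
     forall n : nat, error J w u n = error J w' u' n).
Proof.
have iter_eq n : iterate J w' u' n = iterate J w u n + (u' - u).
  by rewrite /iterate (run_translate Q_bounded same_initial_residual).
split=> [n|Mww'].
  rewrite /residual iter_eq (gradient_translate Q_bounded same_initial_residual).
  by rewrite addrAC subrr add0r.
have Mw : pinv_domain Q w.
  by case: Mww' => // /(pinv_domain_translate Q_bounded same_initial_residual).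
have Mw' := (pinv_domain_translate Q_bounded same_initial_residual).2 Mw.
split; first exact: error_definedP.
split=> [|n]; first exact: error_definedP.
rewrite /error iter_eq (orth_proj_translate Q_bounded same_initial_residual Mw).
by rewrite opprD addrACA subrr addr0.
Qed.
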